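(* Let $G$ be a group, let $P$ be a property of finite subsets of a group that respects extensions, and let $\mathcal{C}$ be a class of groups having local property $P$. Then $G$ is locally projectable to $\mathcal{C}$ if and only if $G \in \mathcal{C}$.
   Context: $P$ is a property of a finite subset of a group; it is supposed that the empty set always has property $P$. For a subset $X$ of a group, $\langle X \rangle$ denotes the subgroup generated by $X$. Property $P$ \emph{respects extensions} if for every nonempty finite subset $X$ of a group $G$ and every short exact sequence $1 \to K \to \langle X \rangle \xrightarrow{q} H \to 1$ where $H$ is nontrivial, the following holds: if all finite subsets $Y \subset K$ with $|Y| < |X|$ have property $P$ and $q(X)$ has property $P$, then $X$ has property $P$. A class of groups $\mathcal{C}$ \emph{has local property} $P$ if it is defined by: a group $G$ is in $\mathcal{C}$ if and only if every nonempty finite subset of $G$ has property $P$. A group $G$ is \emph{locally projectable to} $\mathcal{C}$ if for every nontrivial finitely generated subgroup $F \subset G$ there is a nontrivial group $H \in \mathcal{C}$ and a surjective homomorphism $\phi : F \to H$.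
   Formalization: It is assumed that G is nontrivial or {1} has property P (for trivial G the claim fails, e.g. P = ''X is empty''), and ''property of a finite subset of a group'' is read as unchanged under passing to subgroups and under isomorphism. *)

(* Defs.v *)
From HB Require Import structures.
From mathcomp Require Import all_boot finmap boolp.

Set Implicit Arguments.
Unset Strict Implicit.
Unset Printing Implicit Defensive.

Local Open Scope fset_scope.
Local Open Scope group_scope.

Definition nontrivial (G : groupType) : Prop := exists x : G, x <> 1.

Definition generated (G : groupType) (X : {fset G}) : pred G :=
  fun x => `[< forall S : {pred G},
                 group_closed S -> {subset X <= S} -> x \in S >].

Lemma generated_group_closed (G : groupType) (X : {fset G}) :
  group_closed (generated X).
Proof.
split=> [|x y /asboolP Xx /asboolP Xy]; first by apply/asboolP => S [].
by apply/asboolP => S clS XS; apply: clS.2; [apply: Xx|apply: Xy].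
Qed.

(* The subgroup <X> as a group in its own right. *)
Definition gen_group (G : groupType) (X : {fset G}) : Type :=
  {x : G | generated X x}.

HB.instance Definition _ (G : groupType) (X : {fset G}) :=
  SubChoice.on (gen_group X).
HB.instance Definition _ (G : groupType) (X : {fset G}) :=
  SubChoice_isSubGroup.Build G (generated X) (gen_group X)
    (@generated_group_closed G X).

(* The set X seen inside <X>; the default value 1 of [insubd] is never used,
   since X is contained in <X>. *)
Definition gen_fset (G : groupType) (X : {fset G}) : {fset gen_group X} :=
  [fset insubd (1 : gen_group X) x | x in X].

Definition finitely_generated (F : groupType) : Prop :=
  exists A : {fset F}, forall x : F, x \in generated A.

Definition surjective (A B : Type) (f : A -> B) : Prop :=
  forall b, exists a, f a = b.

(* 1 -> K -> E -> H -> 1 *)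
Definition short_exact (K E H : groupType)
    (i : {multiplicative K -> E}) (q : {multiplicative E -> H}) : Prop :=
  [/\ injective i,
      forall x : E, q x = 1 <-> exists k : K, i k = x
    & surjective q].

Definition group_class := groupType -> Prop.

Definition subset_property := forall G : groupType, {fset G} -> Prop.

(* Whether X has the property depends on the multiplication of the elements of
   X only: it is the same in a subgroup as in the ambient group, and it is
   preserved by isomorphisms. *)
Definition intrinsic (P : subset_property) : Prop :=
  forall (G G' : groupType) (f : {multiplicative G -> G'}), injective f ->
  forall X : {fset G}, P G X <-> P G' [fset f x | x in X].

Definition respects_extensions (P : subset_property) : Prop :=
  forall (G : groupType) (X : {fset G}), X != fset0 ->
  forall (K H : groupType) (i : {multiplicative K -> gen_group X})
         (q : {multiplicative gen_group X -> H}),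
    short_exact i q -> nontrivial H ->
    (forall Y : {fset K}, #|` Y| < #|` X| -> P K Y) ->
    P H [fset q x | x in gen_fset X] ->
    P G X.

Definition has_local_property (C : group_class) (P : subset_property) : Prop :=
  forall G : groupType, C G <-> forall X : {fset G}, X != fset0 -> P G X.

(* [subGroupType S] is the type of groups whose carrier is the subset S of G,
   with the multiplication of G; every subgroup of G arises in this way. *)
Definition locally_projectable (G : groupType) (C : group_class) : Prop :=
  forall (S : pred G) (F : subGroupType S),
    nontrivial F -> finitely_generated F ->
    exists H : groupType, [/\ nontrivial H, C H
      & exists phi : {multiplicative F -> H}, surjective phi].

(* Main.v *)
Require Import Defs.
From HB Require Import structures.
From mathcomp Require Import all_boot finmap boolp.

Local Open Scope fset_scope.
Local Open Scope group_scope.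

(** Suppose that G is locally projectable to C. By strong induction on |X|,
every nonempty finite subset X of G has P: project <X> onto a nontrivial group
H in C with kernel K; the smaller subsets of K have P by induction, since K
embeds in G, and the image of X has P because H is in C. This needs <X>
nontrivial. If <X> is trivial and G is not, take any nontrivial H in C onto
which a cyclic subgroup of G projects: <X> embeds in H, where all finite
subsets have P. *)

Lemma imfset_eq0 (T U : choiceType) (f : T -> U) (A : {fset T}) :
  ([fset f x | x in A] == fset0) = (A == fset0).
Proof.
apply/idP/idP => [|/eqP ->]; last by rewrite imfset0.
apply: contraTT => /fset0Pn[x Ax].
by apply/fset0Pn; exists (f x); apply: in_imfset.
Qed.

Section Generated.
Variables (G : groupType) (X : {fset G}).

Lemma sub_generated : {subset X <= generated X}.
Proof. by move=> x Xx; apply/asboolP => S _; apply. Qed.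

Lemma val_gen_fset : [fset val x | x in gen_fset X] = X.
Proof.
rewrite -imfset_comp -[RHS]imfset_id; apply: eq_in_imfset => x Xx /=.
by rewrite insubdK // sub_generated.
Qed.

Lemma gen_fset_eq0 : (gen_fset X == fset0) = (X == fset0).
Proof. exact: imfset_eq0. Qed.

(** Generation has to be checked against subgroups [S] of [gen_group X], whereas [valP] only speaks
    of subgroups of [G]. Pushing [S] forward along [val] gives a subgroup [vS] of [G] that contains
    [X]. *)
Lemma gen_group_finitely_generated : finitely_generated (gen_group X).
Proof.
exists (gen_fset X) => x; apply/asboolP => S [S1 SF] XS.
pose vS : pred G := fun g => `[< exists2 y : gen_group X, y \in S & val y = g >].
have vS_closed : group_closed vS.
  split; first by apply/asboolP; exists 1; rewrite ?val1.
  move=> _ _ /asboolP[a Sa <-] /asboolP[b Sb <-].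
  by apply/asboolP; exists (a / b); rewrite ?gmulfF // SF.
have XvS : {subset X <= vS}.
  move=> g Xg; apply/asboolP; exists (insubd 1 g); first exact/XS/in_imfset.
  by rewrite insubdK // sub_generated.
have /asboolP[y Sy /val_inj <- //] : vS (val x).
by have /asboolP genx := valP x; apply: (genx vS).
Qed.

End Generated.

Section Kernel.
Variables (E H : groupType) (q : {multiplicative E -> H}).

Definition kernel : pred E := fun x => q x == 1.

Lemma kernel_group_closed : group_closed kernel.
Proof.
have q1 : q 1 = 1 by apply: (mulgI (q 1)); rewrite -gmulfM !mulg1.
split=> [|x y /eqP qx /eqP qy]; apply/eqP; first exact: q1.
by rewrite gmulfM qx -qy -gmulfM mulgV q1.
Qed.

Definition ker_group : Type := {x : E | kernel x}.

HB.instance Definition _ := SubChoice.on ker_group.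
HB.instance Definition _ :=
  SubChoice_isSubGroup.Build E kernel ker_group kernel_group_closed.

Lemma ker_group_short_exact :
  surjective q -> short_exact (val : {multiplicative ker_group -> E}) q.
Proof.
split=> // [|x]; first exact: val_inj.
split=> [/eqP qx|[k <-]]; first by exists (exist _ x qx).
exact/eqP/(valP k).
Qed.

End Kernel.

Section LocallyProjectable.
Variables (G : groupType) (P : subset_property) (C : group_class).
Hypotheses (P_intrinsic : intrinsic P) (C_local : has_local_property C P).

Lemma class_sub_closed (L : groupType) (f : {multiplicative L -> G}) :
  injective f -> C G -> C L.
Proof.
move=> f_inj /C_local PG; apply/C_local => X X0.
by apply/(P_intrinsic _ _ _ f_inj)/PG; rewrite imfset_eq0.
Qed.

(** As [C] passes to subgroups, each [F] can be projected onto itself. *)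
Lemma class_locally_projectable : C G -> locally_projectable G C.
Proof.
move=> CG S F F_nontriv _; exists F; split=> //.
  exact: (class_sub_closed F val val_inj CG).
by exists idfun => x; exists x.
Qed.

Hypothesis G_proj : locally_projectable G C.

Lemma property_gen_trivial (X : {fset G}) :
    X != fset0 -> nontrivial G -> ~ nontrivial (gen_group X) -> P G X.
Proof.
move=> X0 [g g1] X_triv.
have triv1 (x : gen_group X) : x = 1.
  by apply: contra_notP X_triv => x1; exists x.
pose Z := gen_group [fset g].
have Z_nontriv : nontrivial Z.
  have Zg := sub_generated G [fset g] g (fset11 g).
  exists (Sub g Zg); apply: contra_not g1 => /(congr1 val).
  by rewrite SubK val1.
have [H [_ /C_local PH _]] :=
  G_proj _ Z Z_nontriv (gen_group_finitely_generated _ _).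
rewrite -(val_gen_fset G X); apply/(P_intrinsic _ _ val val_inj).
(* On a trivial group the constant map is injective, so [P] can be pulled back from [H] along it. *)
pose e : {multiplicative gen_group X -> H} := @one_fun (gen_group X) H.
have e_inj : injective e by move=> x y _; rewrite (triv1 x) (triv1 y).
by apply/(P_intrinsic _ _ _ e_inj)/PH; rewrite imfset_eq0 gen_fset_eq0.
Qed.

Hypotheses (P_empty : forall L : groupType, P L fset0)
  (P_ext : respects_extensions P).

Lemma property_gen_nontrivial (X : {fset G}) :
    X != fset0 -> nontrivial (gen_group X) ->
    (forall Y : {fset G}, Y != fset0 -> #|` Y| < #|` X| -> P G Y) -> P G X.
Proof.
move=> X0 X_nontriv IH.
have [H [H_nontriv /C_local PH [q q_surj]]] :=
  G_proj _ (gen_group X) X_nontriv (gen_group_finitely_generated _ _).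
apply: (P_ext _ _ X0 _ _ _ _ (ker_group_short_exact _ _ q q_surj) H_nontriv).
  (* [P_ext] also asks for the empty [Y], which [IH] does not cover. *)
  move=> Y YX; have [->|Y0] := eqVneq Y fset0; first exact: P_empty.
  (* The two embeddings are of the kernel into [gen_group X] and of [gen_group X] into [G]; both
     preserve cardinality. *)
  apply/(P_intrinsic _ _ val val_inj)/(P_intrinsic _ _ val val_inj).
  apply: IH; rewrite ?imfset_eq0 //.
  by rewrite !card_imfset //; apply: val_inj.
by apply: PH; rewrite imfset_eq0 gen_fset_eq0.
Qed.

End LocallyProjectable.

Theorem theorem1p1 (G : groupType) (P : subset_property) (C : group_class)
    (P_intrinsic : intrinsic P)
    (P_empty : forall L : groupType, P L fset0)
    (P_ext : respects_extensions P)
    (C_local : has_local_property C P)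
    (* for trivial G, the equivalence amounts to the second alternative *)
    (G_nondegenerate : nontrivial G \/ P G [fset 1]) :
  locally_projectable G C <-> C G.
Proof.
split=> [G_proj|]; last exact: (class_locally_projectable G P).
apply/C_local => X; have [n] := ubnP #|` X|.
elim: n X => // n IHn X /ltnSE leXn X0.
have [X_nontriv|X_triv] := pselect (nontrivial (gen_group X)).
  apply: (property_gen_nontrivial G P C) => // Y Y0 YX.
  by apply: IHn => //; apply: leq_trans leXn.
(* Here [X] can only be {1}. A trivial [G] is locally projectable vacuously, which yields no [H] to
   test {1} in; [P1] then settles this case directly. *)
case: G_nondegenerate => [G_nontriv|P1].
  exact: (property_gen_trivial G P C).
have X1 x : x \in X -> x = 1.
  move=> /(sub_generated G X) Xx; apply: contra_notP X_triv => x1.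
  by exists (Sub x Xx); apply: contra_not x1 => /(congr1 val); rewrite SubK val1.
suff -> : X = [fset 1] by [].
have /fset0Pn[x Xx] := X0.
apply/fsetP => y; rewrite inE; apply/idP/eqP => [/X1 //|->].
by rewrite -(X1 _ Xx).
Qed.
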